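(* There exists a function $f:(0,\infty)\to\mathbb{R}$ such that for every $\epsilon>0$, every finite simple graph $G$ with $\mathrm{mad}(G)<3-\epsilon$ and $\Delta(G)\ge f(\epsilon)$ satisfies $\chi^i_\ell(G)=\Delta(G)$.
   Context: $\Delta(G)$ is the maximum degree of $G$. The maximum average degree $\mathrm{mad}(G)$ is the maximum of $2|E(H)|/|V(H)|$ over all subgraphs $H$ of $G$. A list injective $k$-coloring of $G$ with respect to an assignment of lists of $k$ colors to the vertices is a (not necessarily proper) coloring of the vertices, each vertex receiving a color from its list, such that any two distinct vertices having a common neighbor receive different colors. $\chi^i_\ell(G)$ is the smallest $k$ such that $G$ admits a list injective $k$-coloring for every assignment of lists of size $k$. *)

(* Defs.v *)
From mathcomp Require Import all_boot.
From Stdlib Require Import Reals.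
Set Implicit Arguments. Unset Strict Implicit. Unset Printing Implicit Defensive.

(* A finite simple graph is a vertex type T : finType with an adjacency
   relation e : rel T which is symmetric and irreflexive. *)

Section Graph.
Variables (T : finType) (e : rel T).

Definition deg (v : T) : nat := #|[set u | e v u]|.

(* maximum degree Delta(G) (0 for the empty graph) *)
Definition maxdeg : nat := \max_(v : T) deg v.

Definition induced_edges (S : {set T}) : {set {set T}} :=
  [set A : {set T} | (A \subset S) &&
     [exists x : T, exists y : T, (A == [set x; y]) && e x y]].

(* maximum average degree: max over nonempty vertex sets S of 2|E(G[S])|/|S|
   (it suffices to consider induced subgraphs; value 0 for the empty graph) *)
Definition mad : R :=
  \big[Rmax/0%R]_(S : {set T} | S != set0)
     (2 * INR #|induced_edges S| / INR #|S|)%R.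

Definition common_nb (u v : T) : bool := [exists w, e u w && e v w].

Definition list_assignment (k : nat) (L : T -> seq nat) : Prop :=
  forall v, uniq (L v) /\ size (L v) = k.

Definition list_injective_coloring (L : T -> seq nat) (c : T -> nat) : Prop :=
  (forall v, c v \in L v) /\
  (forall u v, u != v -> common_nb u v -> c u != c v).

Definition inj_choosable (k : nat) : Prop :=
  forall L, list_assignment k L -> exists c, list_injective_coloring L c.

Definition list_inj_chromatic_eq (k : nat) : Prop :=
  inj_choosable k /\ forall k', k' < k -> ~ inj_choosable k'.

End Graph.

(* Main.v *)
Require Import Defs.
From mathcomp Require Import all_boot.
From mathcomp Require Import zify.
From Stdlib Require Import Reals Lra ZArith.
Set Implicit Arguments. Unset Strict Implicit. Unset Printing Implicit Defensive.

(* Injective colorings of G are colorings of one side of its bipartite double cover in which every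
   neighborhood of the other side is rainbow, and the double cover is as sparse as G. A discharging
   argument shows that every nonempty set U of vertices contains either a vertex with fewer than k - 1
   conflicts inside U, which can be colored last, or a vertex y such that many neighbors of y in U are
   "good": apart from the neighborhood of y, they have at most one conflict, called their parent.
   Peeling off such vertices and such blocks of neighbors exhausts G, and the coloring is built in the
   reverse order. A block together with the rest of the neighborhood of y may use up all k colors, so
   each of its last two vertices z, z' may be left with one color. These colors coincide only if
   L z minus the color of the parent of z equals L z' minus the color of the parent of z'; this is
   prevented by excluding one more color when the later of the two parents is colored. Hall's theorem
   provides pairs for which distinct vertices have distinct parents and no parent belongs to a pair, so
   that this costs every vertex at most one color and costs the last two vertices none. *)

(** * Hall's theorem and the selection of distinct representatives *)

Section Hall.
Variables (A B : finType) (b0 : B).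

(** Induction on the size of [D]. A proper nonempty tight set [S] is matched on its own, and the
    rest is matched outside [NS]. Without such a set any [a] and [b] may be matched first, because
    every proper nonempty subset has a neighbor to spare. *)
Lemma hall_on (D : {set A}) (r : A -> {set B}) :
  (forall S : {set A}, S \subset D -> #|S| <= #|\bigcup_(a in S) r a|) ->
  exists f : A -> B, {in D &, injective f} /\ {in D, forall a, f a \in r a}.
Proof.
have [n] := ubnP #|D|; elim: n D r => // n IHn D r leDn hall.
have [->|[a aD]] := set_0Vmem D.
  by exists (fun=> b0); split=> x; rewrite inE.
have [/existsP [S /and4P [SD S0 Dn tight]]|] :=
  boolP [exists S : {set A}, [&& S \subset D, S != set0, S != D &
           #|\bigcup_(a in S) r a| <= #|S|]].
  have ltSD : #|S| < #|D|.
    by apply: proper_card; rewrite properEneq Dn SD.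
  have cardS : 0 < #|S| by rewrite card_gt0.
  have [||f [finj fr]] := IHn S r.
  - lia.
  - by move=> S' S'S; apply: hall; apply: subset_trans SD.
  pose NS := \bigcup_(a in S) r a.
  have [||g [ginj gr]] := IHn (D :\: S) (fun a => r a :\: NS).
  - by have := cardsID S D; rewrite (setIidPr SD); lia.
  - move=> S' S'D.
    have dis : [disjoint S & S'].
      rewrite disjoint_sym; apply: disjointWl S'D _.
      by rewrite -setI_eq0 setDE -setIA [_ :&: S]setIC setICr setI0.
    (* Hall's condition for the union, minus the tight set, gives Hall's condition for [S'] outside
       [NS]. *)
    have := hall (S :|: S'); rewrite subUset SD (subset_trans S'D (subsetDl _ _)).
    rewrite cardsU (disjoint_setI0 dis) cards0 subn0 => /(_ isT).
    rewrite bigcup_setU -/NS => h.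
    have sub : NS :|: \bigcup_(i in S') r i \subset
               NS :|: \bigcup_(i in S') (r i :\: NS).
      apply/subsetP=> b; rewrite !inE; case: (boolP (b \in NS)) => //= bN.
      move=> /bigcupP [i iS' bi]; apply/bigcupP; exists i => //.
      by rewrite inE bN.
    have := leq_trans h (subset_leq_card sub).
    rewrite cardsU => h2; have := tight; rewrite -/NS; lia.
  exists (fun x => if x \in S then f x else g x); split.
    move=> x y xD yD.
    have inN z : z \in S -> f z \in NS by move=> zS; apply/bigcupP; exists z; rewrite ?fr.
    have niN z : z \in D -> z \notin S -> g z \notin NS.
      by move=> zD zS; have := gr z; rewrite !inE zS zD => /(_ isT) /andP [].
    case: (boolP (x \in S)) => xS; case: (boolP (y \in S)) => yS.
    - exact: finj.
    - by move=> E; have := inN _ xS; rewrite E (negPf (niN _ yD yS)).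
    - by move=> E; have := inN _ yS; rewrite -E (negPf (niN _ xD xS)).
    - by apply: ginj; rewrite inE ?xS ?yS.
  move=> x xD; case: (boolP (x \in S)) => xS; first exact: fr.
  by have := gr x; rewrite !inE xS xD => /(_ isT) /andP [].
move=> /existsPn loose.
have [b ba] : exists b, b \in r a.
  have := hall [set a]; rewrite sub1set aD cards1 big_set1 => /(_ isT).
  by move=> /card_gt0P.
have [||g [ginj gr]] := IHn (D :\ a) (fun x => r x :\ b).
- by have := cardsD1 a D; rewrite aD; lia.
- move=> S SD; have [->|S0] := eqVneq S set0; first by rewrite cards0.
  have sub : \bigcup_(i in S) r i \subset b |: \bigcup_(i in S) (r i :\ b).
    apply/subsetP=> c /bigcupP [i iS ci]; rewrite !inE.
    case: eqVneq => //= cb; apply/bigcupP; exists i => //.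
    by rewrite !inE cb.
  have := loose S; rewrite (subset_trans SD (subD1set _ _)) S0 /=.
  have -> /= : S != D.
    by apply: contraTneq SD => ->; apply/subsetPn; exists a => //; rewrite !inE eqxx.
  rewrite -ltnNge => h.
  have := leq_trans h (subset_leq_card sub); rewrite cardsU1; lia.
exists (fun x => if x == a then b else g x); split.
  move=> x y xD yD; case: eqVneq => [->|xa]; case: eqVneq => [->|ya] //.
  - by move=> E; have := gr y; rewrite !inE ya yD -E eqxx => /(_ isT).
  - by move=> E; have := gr x; rewrite !inE xa xD E eqxx => /(_ isT).
  - by apply: ginj; rewrite !inE ?xa ?ya.
move=> x xD; case: eqVneq => [->//|xa].
by have := gr x; rewrite !inE xa xD => /(_ isT) /andP [].
Qed.

End Hall.

Lemma card_le_fibres (X Y : finType) (c : nat) (D : {set X}) (g : X -> Y) :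
  (forall y, #|[set x in D | g x == y]| <= c) -> #|D| <= c * #|g @: D|.
Proof.
move=> h; rewrite -sum1_card (partition_big_imset g) /= mulnC -sum_nat_const.
apply: leq_sum => y _; apply: leq_trans (h y); rewrite sum1dep_card.
by rewrite leq_eqVlt; apply/orP; left; apply/eqP/eq_card=> x; rewrite !inE.
Qed.

(** Hall's theorem matches [r] copies of each key of [J] to tokens. Copies of [s] keys number at
    most [r * s]; at least [c * r * s] elements of [G] have these keys, and as a token is shared by
    at most [c] of them, at least [r * s] tokens occur. *)
Lemma select_distinct_tokens (X I V : finType) (key : X -> I) (tok : X -> V)
    (J : {set I}) (G : {set X}) (c r : nat) :
  0 < c ->
  (forall v, #|[set x in G | tok x == v]| <= c) ->
  {in J, forall i, c * r <= #|[set x in G | key x == i]|} ->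
  exists R : {set X}, [/\ R \subset G, {in R &, injective tok} &
    {in J, forall i, r <= #|[set x in R | key x == i]|}].
Proof.
move=> c_gt0 fib big; pose Z i := [set x in G | key x == i].
have [r0|r_gt0] := posnP r.
  exists set0; split=> [|x y|i _]; first exact: sub0set; first by rewrite inE.
  by rewrite r0.
have [J0|[i0 i0J]] := set_0Vmem J.
  exists set0; split=> [|x y|i]; first exact: sub0set; first by rewrite inE.
  by rewrite J0 inE.
have [x0 _] : exists x, x \in Z i0.
  by apply/card_gt0P; apply: leq_trans (big _ i0J); rewrite muln_gt0 c_gt0.
pose D := [set u : I * 'I_r | u.1 \in J].
have [|f [finj fZ]] := @hall_on _ _ (tok x0) D (fun u => tok @: Z u.1).
  move=> S SD; pose S1 := [set u.1 | u in S].
  have leS : #|S| <= r * #|S1|.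
    apply: card_le_fibres => i.
    apply: (@leq_trans #|[set (i, j) | j : 'I_r]|); last first.
      by apply: leq_trans (leq_imset_card _ _) _; rewrite card_ord.
    apply/subset_leq_card/subsetP=> -[i' j]; rewrite inE /= => /andP [_ /eqP ->].
    by apply/imsetP; exists j.
  pose ZS := [set x in G | key x \in S1].
  have -> : \bigcup_(u in S) tok @: Z u.1 = tok @: ZS.
    apply/setP=> v; apply/bigcupP/imsetP => [[u uS /imsetP [x xZ ->]]|[x xZ ->]].
      exists x => //; move: xZ; rewrite !inE => /andP [-> /eqP ->] /=.
      by apply/imsetP; exists u.
    move: xZ; rewrite inE => /andP [xG /imsetP [u uS E]].
    by exists u => //; apply/imsetP; exists x => //; rewrite inE xG E /=.
  have leZ : #|ZS| <= c * #|tok @: ZS|.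
    apply: card_le_fibres => v; apply: leq_trans (fib v).
    by apply/subset_leq_card/subsetP=> x; rewrite !inE -andbA => /and3P [-> _ ->].
  have geZ : c * r * #|S1| <= #|ZS|.
    rewrite -[#|ZS|]sum1_card (partition_big key (mem S1)) /=; last first.
      by move=> x; rewrite inE => /andP [].
    rewrite mulnC -sum_nat_const; apply: leq_sum => i iS1.
    have iJ : i \in J.
      by case/imsetP: iS1 => u uS ->; have := subsetP SD _ uS; rewrite inE.
    apply: leq_trans (big _ iJ) _; rewrite sum1dep_card.
    apply/subset_leq_card/subsetP=> x; rewrite !inE => /andP [-> /eqP ->].
    by rewrite iS1 eqxx.
  have : c * (r * #|S1|) <= c * #|tok @: ZS| by apply: leq_trans leZ; rewrite mulnA.
  by rewrite leq_pmul2l // => h; apply: leq_trans leS h.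
pose z u := odflt x0 [pick x in Z u.1 | tok x == f u].
have zP u : u \in D -> (z u \in Z u.1) /\ tok (z u) = f u.
  move=> uD; rewrite /z; case: pickP => [x /andP [xZ /eqP E]|none] //=.
  by have /imsetP [x xZ E] := fZ u uD; have := none x; rewrite xZ E eqxx.
exists (z @: D); split.
- apply/subsetP=> x /imsetP [u /zP [uZ _] ->].
  by move: uZ; rewrite inE => /andP [].
- move=> x y /imsetP [u uD ->] /imsetP [v vD ->].
  by rewrite (zP u uD).2 (zP v vD).2 => /(finj _ _ uD vD) ->.
move=> i iJ; have jD (j : 'I_r) : (i, j) \in D by rewrite inE.
have zinj : injective (fun j : 'I_r => z (i, j)).
  move=> j j' /(congr1 tok); rewrite (zP _ (jD j)).2 (zP _ (jD j')).2.
  by move=> /(finj _ _ (jD j) (jD j')) [].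
rewrite -[r in r <= _]card_ord -cardsT -(card_imset _ zinj).
apply/subset_leq_card/subsetP=> x /imsetP [j _ ->].
have := (zP _ (jD j)).1; rewrite !inE => /andP [_ ->]; rewrite andbT.
by apply/imsetP; exists (i, j).
Qed.

Lemma leq_sum_const (X : finType) (D : {set X}) (F : X -> nat) (c : nat) :
  {in D, forall x, c <= F x} -> #|D| * c <= \sum_(x in D) F x.
Proof. by move=> h; rewrite -sum_nat_const; apply: leq_sum. Qed.

Lemma card_bigcup_leq (X Y : finType) (D : {set X}) (F : X -> {set Y}) :
  #|\bigcup_(x in D) F x| <= \sum_(x in D) #|F x|.
Proof.
elim/big_rec2: _ => [|x m S _ h]; first by rewrite cards0.
by apply: leq_trans (leq_card_setU _ _) _; rewrite leq_add2l.
Qed.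

(** * The double cover, conflicts and blocks *)

Section Peeling.
Variables (T : finType) (e : rel T).
Hypothesis e_sym : symmetric e.
Implicit Types (U V S : {set T}) (x y z p : T).

Definition nbhd y : {set T} := [set x | e y x].
Definition arcs U V : {set T * T} := [set u | [&& u.1 \in U, u.2 \in V & e u.1 u.2]].

Lemma arcs_sym U V : #|arcs U V| = #|arcs V U|.
Proof.
have sw_inj : injective (fun u : T * T => (u.2, u.1)) by move=> [a b] [c d] [-> ->].
rewrite -(card_imset _ sw_inj); apply: eq_card => -[a b]; rewrite inE /=.
apply/imsetP/and3P => [[[c d]]|[aV bU ab]].
  by rewrite inE /= => /and3P [cU dV cd] [-> ->]; rewrite e_sym.
by exists (b, a); rewrite ?inE /= ?aV ?bU 1?e_sym.
Qed.

Lemma card_arcs U V : #|arcs U V| = \sum_(y in U) #|nbhd y :&: V|.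
Proof.
under eq_bigr do rewrite -sum1_card.
rewrite pair_big_dep /= sum1dep_card; apply: eq_card => -[a b].
by rewrite !inE /= [e a b && _]andbC.
Qed.

Lemma arcs_induced S : #|arcs S S| <= 2 * #|induced_edges e S|.
Proof.
pose h (u : T * T) := [set u.1; u.2].
apply: leq_trans (@card_le_fibres _ _ 2 _ h _) _.
  move=> A; case: (set_0Vmem [set u in arcs S S | h u == A]) => [->|[[a b]]].
    by rewrite cards0.
  rewrite !inE /= => /andP [_ /eqP <-].
  apply: (@leq_trans #|[set (a, b); (b, a)]|); last by rewrite cards2; case: eqP.
  apply/subset_leq_card/subsetP=> -[c d]; rewrite !inE /= => /andP [_ /eqP E].
  rewrite !xpair_eqE.
  have : c \in [set a; b] by rewrite -[[set a; b]]E !inE eqxx.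
  have : d \in [set a; b] by rewrite -[[set a; b]]E !inE eqxx orbT.
  have : a \in h (c, d) by rewrite E !inE eqxx.
  have : b \in h (c, d) by rewrite E !inE eqxx orbT.
  rewrite !inE /= => /orP [] /eqP-> /orP [] /eqP->;
    by rewrite ?eqxx ?orbT ?orbb ?andbT // => /eqP->; rewrite ?eqxx.
rewrite leq_mul2l /=; apply/subset_leq_card/subsetP=> A /imsetP [[a b]].
rewrite !inE /= => /and3P [aS bS ab] ->; rewrite subUset !sub1set aS bS /=.
by apply/existsP; exists a; apply/existsP; exists b; rewrite eqxx.
Qed.

(* Submodularity carries the sparsity of the graph over to its bipartite double cover. *)
Lemma density_double_cover (c d : nat) :
  (forall S, S != set0 -> 2 * c * #|induced_edges e S| < d * #|S|) ->
  forall U V, U != set0 ->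
    2 * c * \sum_(y in V) #|nbhd y :&: U| < d * (#|U| + #|V|).
Proof.
move=> dens U V U0; rewrite -card_arcs.
(* The two arc sets have equal size, so their union and intersection together count the incidences
   twice. *)
have sub : arcs V U :|: arcs U V \subset arcs (U :|: V) (U :|: V).
  apply/subsetP=> -[a b]; rewrite !inE /=.
  by case/orP=> /and3P [-> -> ->]; rewrite ?orbT.
have cap : arcs V U :&: arcs U V \subset arcs (U :&: V) (U :&: V).
  apply/subsetP=> -[a b]; rewrite !inE /=.
  by case/andP=> /and3P [-> -> ->] /and3P [-> -> _].
have := cardsUI (arcs V U) (arcs U V); rewrite (arcs_sym U V).
have := leq_trans (subset_leq_card sub) (arcs_induced _).
have := leq_trans (subset_leq_card cap) (arcs_induced _).
have UV0 : U :|: V != set0 by rewrite setU_eq0 negb_and U0.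
have := dens _ UV0.
have : 2 * c * #|induced_edges e (U :&: V)| <= d * #|U :&: V|.
  have [->|/dens/ltnW//] := eqVneq (U :&: V) set0.
  rewrite cards0 muln0 leqn0 muln_eq0 cards_eq0; apply/orP; right; apply/eqP/setP=> A.
  rewrite !inE subset0; apply/negbTE; apply/negP=> /andP [/eqP -> /existsP [x]].
  move=> /existsP [y /andP [/eqP E _]].
  by have := in_set0 x; rewrite E !inE eqxx.
have := cardsUI U V; nia.
Qed.

Definition conf x : {set T} := [set u | (u != x) && common_nb e u x].

Section Restricted.
Variable U : {set T}.

(* Degrees in the double cover restricted to [U]; a neighborhood meeting [U] in at most one vertex
   is no constraint, and [vdeg] ignores it. *)
Definition hdeg y : nat := #|nbhd y :&: U|.
Definition vdeg x : nat := #|[set y | e x y & 1 < hdeg y]|.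

Variable M : nat.

(** All hyperedges at a block vertex except that of [y] are small and few, so by [conf_bound] at
    most [M * M] conflicts come from them. *)
Definition block y : {set T} := [set x in U | [&& e y x, vdeg x <= M &
  [forall y', (y' != y) ==> e x y' ==> (hdeg y' <= M)]]].

(** The conflict [p] outside the neighborhood of [y] is the future parent. The conditions on it
    bound the number of vertices sharing a parent; see [card_children]. *)
Definition goods y : {set T} := [set z in block y |
  (#|(conf z :&: U) :\: nbhd y| <= 1) &&
  [forall p in (conf z :&: U) :\: nbhd y,
     (vdeg p <= M) && [exists y', nbhd y' :&: U == [set z; p]]]].

(** A conflict comes from a common neighbor. Apart from [y0], at most [M] neighbors of [x] produce
    conflicts, each at most [M] of them. *)
Lemma conf_bound V x y0 : V \subset U -> x \in U -> vdeg x <= M ->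
  (forall y, y != y0 -> e x y -> hdeg y <= M) ->
  #|conf x :&: V| <= (if e x y0 then #|(nbhd y0 :&: V) :\ x| else 0) + M * M.
Proof.
move=> VU xU xM small.
pose Yx := [set y | e x y & 1 < hdeg y] :\ y0.
pose A := if e x y0 then (nbhd y0 :&: V) :\ x else set0.
have sub : conf x :&: V \subset A :|: \bigcup_(y in Yx) (nbhd y :&: U).
  apply/subsetP=> u; rewrite !inE => /andP [/andP [ux /existsP [w /andP [uw xw]]] uV].
  have [E|wy0] := eqVneq w y0.
    by rewrite /A -E xw !inE ux uV e_sym uw.
  apply/orP; right; apply/bigcupP; exists w; last by rewrite !inE e_sym uw (subsetP VU).
  rewrite !inE wy0 xw /=; apply: (@leq_trans #|[set u; x]|).
    by rewrite cards2 ux.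
  apply/subset_leq_card/subsetP=> v; rewrite !inE.
  case/orP=> /eqP->; first by rewrite e_sym uw (subsetP VU).
  by rewrite e_sym xw.
apply: leq_trans (subset_leq_card sub) _; apply: leq_trans (leq_card_setU _ _) _.
apply: leq_add; first by rewrite /A; case: ifP; rewrite ?cards0.
apply: leq_trans (card_bigcup_leq _ _) _.
apply: (@leq_trans (#|Yx| * M)); last first.
  rewrite leq_mul2r; apply/orP; right; apply: leq_trans xM.
  by apply/subset_leq_card; apply: subD1set.
rewrite -sum_nat_const; apply: leq_sum => y; rewrite !inE => /and3P [yy0 xy _].
exact: small.
Qed.

Lemma blockP y x : x \in block y -> [/\ x \in U, e y x, vdeg x <= M &
  forall y', y' != y -> e x y' -> hdeg y' <= M].
Proof.
rewrite inE => /and4P [-> -> -> /forallP h]; split=> // y' yy' xy'.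
by have := h y'; rewrite yy' xy'.
Qed.

End Restricted.
End Peeling.

(** * Discharging: every nonempty [U] is reducible *)

Section Discharging.
Variables (T : finType) (e : rel T).
Hypotheses (e_sym : symmetric e) (e_irr : irreflexive e).
Variables (n k N : nat) (U : {set T}).
Let M := 3 * n.
Hypothesis n_gt0 : 0 < n.
Hypothesis k_large : M * M + n * N + M + 2 <= k.
Hypothesis U_neq0 : U != set0.
Hypothesis dens : forall V : {set T},
  2 * n * \sum_(y in V) #|nbhd e y :&: U| < (3 * n - 1) * (#|U| + #|V|).
Hypothesis no_low_conf : forall x, x \in U -> k <= #|conf e x :&: U| + 1.
Hypothesis few_goods : forall y, #|goods e U M y| < N.
Local Notation hdeg := (hdeg e U).
Local Notation vdeg := (vdeg e U).
Local Notation goods := (goods e U M).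

Let Yx x : {set T} := [set y | e x y & 1 < hdeg y].
Let bigs x : {set T} := [set y | e x y & M < hdeg y].
Let low y := (hdeg y == 2) && [forall p in nbhd e y :&: U, vdeg p <= M].
Let G := \bigcup_y goods y.

(* Every incidence of [x] and [y] carries [4 n], shared as [wX x y + wY x y]; each vertex of the
   double cover needs [6 n - 2]. *)
Let wY x y := if M < hdeg y then 2 else
  if (M < vdeg x) || (1 < #|bigs x|) then 4 * n - 2 else
  if low y then 3 * n else 2 * n.
Let wX x y := 4 * n - wY x y.

(** At least [k - 1] conflicts exist and at most [M * M] come from elsewhere, so the neighborhood of
    [y] must supply the rest. *)
Lemma goods_hdeg y x : x \in goods y -> k <= hdeg y + M * M.
Proof.
rewrite inE => /andP [/blockP [xU yx xM small] _].
have := conf_bound e_sym (subxx U) xU xM small.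
rewrite e_sym yx; have := no_low_conf xU.
by have := cardsD1 x (nbhd e y :&: U); rewrite !inE yx xU /hdeg; lia.
Qed.

(** The only possible conflict outside the neighborhood of [y0] is the second vertex of the one
    remaining hyperedge, which is low. *)
Lemma one_big_good x y0 : x \in U -> vdeg x <= M -> bigs x = [set y0] ->
  #|Yx x :\ y0| <= 1 -> {in Yx x :\ y0, forall y, low y} -> x \in G.
Proof.
move=> xU xM Ex le1 lowx.
have small y : y != y0 -> e x y -> hdeg y <= M.
  move=> yy0 xy; rewrite leqNgt; apply: contra yy0 => h.
  by rewrite -in_set1 -Ex inE xy.
have xy0 : e x y0 by have := set11 y0; rewrite -Ex inE => /andP [].
have pP p : p \in (conf e x :&: U) :\: nbhd e y0 ->
    exists2 y, y \in Yx x :\ y0 & nbhd e y :&: U = [set x; p].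
  rewrite !inE => /and3P [py0 /andP [px /existsP [w /andP [pw xw]]] pU].
  have wy0 : w != y0 by apply: contraNneq py0 => <-; rewrite e_sym.
  have sub : [set x; p] \subset nbhd e w :&: U.
    by rewrite subUset !sub1set !inE xU pU !andbT ![e w _]e_sym xw.
  have c2 : #|[set x; p]| = 2 by rewrite cards2 eq_sym px.
  have wYx : w \in Yx x :\ y0.
    rewrite !inE wy0 xw /=; apply: leq_trans (subset_leq_card sub).
    by rewrite c2.
  exists w; first exact: wYx.
  apply/eqP; rewrite eq_sym eqEcard sub c2.
  by have /andP [/eqP E _] := lowx _ wYx; rewrite -[#|_ :&: U|]/(hdeg w) E.
apply/bigcupP; exists y0 => //; rewrite inE; apply/andP; split.
  rewrite inE xU e_sym xy0 xM /=; apply/forallP=> y; apply/implyP=> yy0.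
  by apply/implyP; apply: small.
apply/andP; split.
  apply/card_le1_eqP => p q /pP [y yY Ey] pq; move: (pq) => /pP [y' y'Y Ey'].
  move: Ey'; rewrite (card_le1_eqP le1 _ _ yY y'Y) Ey => E.
  have : q \in [set x; p] by rewrite E !inE eqxx orbT.
  move: pq; rewrite !inE => /and3P [_ /andP [/negPf -> _] _].
  by move/eqP.
apply/forallP=> p; apply/implyP=> /pP [y yY Ey]; apply/andP; split; last first.
  by apply/existsP; exists y; apply/eqP.
have /andP [_ /forallP/(_ p)/implyP] := lowx _ yY; apply.
by rewrite Ey !inE eqxx orbT.
Qed.

Lemma bigs_sub x : bigs x \subset Yx x.
Proof. by apply/subsetP=> y; rewrite !inE => /andP [->]; lia. Qed.

(** If [vdeg x] exceeds [3 * n], each incidence leaves 2 to [x]. Two big neighbors give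
    [2 * (4 * n - 2)]; no big neighbor would leave too few conflicts. With exactly one, the missing
    [2 * n] comes from two other incidences, from a single one that is not low, or, if [x] is good,
    from the extra term. *)
Lemma vertex_charge x : x \in U ->
  6 * n - 2 <= \sum_(y in Yx x) wX x y + 2 * n * (x \in G).
Proof.
move=> xU; have [xM|xM] := ltnP M (vdeg x).
  have : {in Yx x, forall y, 2 <= wX x y}.
    by move=> y _; rewrite /wX /wY xM /=; case: ifP; lia.
  move=> /leq_sum_const; have : #|Yx x| = vdeg x by [].
  by rewrite /M in xM *; lia.
have bigsum : #|bigs x| * (4 * n - 2) <= \sum_(y in Yx x) wX x y.
  apply: leq_trans (leq_sum_const (c := 4 * n - 2) (F := wX x) _) _.
    by move=> y; rewrite !inE /wX /wY => /andP [_ ->].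
  by rewrite [leqRHS](big_setID (bigs x)) /= (setIidPr (bigs_sub x)) leq_addr.
have [two|lt2] := ltnP 1 #|bigs x|.
  by nia.
have [/eqP|gt0] := posnP #|bigs x|.
  rewrite cards_eq0 => /eqP none.
  (* Taking [x] itself as the exceptional center makes the first summand vanish, since there are no
     loops. *)
  have := @conf_bound _ _ e_sym U M U x x (subxx _) xU xM _.
  rewrite e_irr => h.
  have := no_low_conf xU; suff : #|conf e x :&: U| <= 0 + M * M by lia.
  apply: h => y _ xy; rewrite leqNgt; apply/negP=> yM.
  by have := in_set0 y; rewrite -none inE xy yM.
have /cards1P [y0 Ey0] : #|bigs x| == 1 by rewrite eqn_leq lt2.
case: (boolP (x \in G)) => xG; first by rewrite Ey0 cards1 in bigsum; lia.
have y0Y : y0 \in Yx x by rewrite (subsetP (bigs_sub x)) // Ey0 set11.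
have w0 : wX x y0 = 4 * n - 2.
  by have := set11 y0; rewrite -Ey0 inE /wX /wY => /andP [_ ->].
rewrite (big_setD1 y0) //= w0.
have wn y : y \in Yx x :\ y0 -> wX x y = if low y then n else 2 * n.
  rewrite !inE => /and3P [yy0 xy _]; rewrite /wX /wY Ey0 cards1 (ltnNge M (vdeg x)) xM /=.
  have -> : (M < hdeg y) = false.
    by apply: contraNF yy0 => yM; rewrite -in_set1 -Ey0 inE xy.
  by case: ifP; lia.
have [le1|gt1] := leqP #|Yx x :\ y0| 1; last first.
  have : {in Yx x :\ y0, forall y, n <= wX x y}.
    by move=> y /wn ->; case: ifP; lia.
  by move=> /leq_sum_const; nia.
have [/forallP all_low|] := boolP [forall y in Yx x :\ y0, low y].
  case/negP: xG; apply: one_big_good Ey0 le1 _ => // y yY.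
  by have := all_low y; rewrite yY.
case/forallPn=> y; rewrite negb_imply => /andP [yY /negPf ylow].
by rewrite (big_setD1 y) //= wn // ylow; lia.
Qed.

(** A big hyperedge gets 2 per vertex; if it has good vertices, [goods_hdeg] and [k_large] make it
    large enough to pay [2 * n] for each of fewer than [N] of them. A small one has no good
    vertices: it gets [2 * n] from three vertices, at least [3 * n - 1] from each end of a low pair,
    or [4 * n - 2] and [2 * n] from a pair that is not low. *)
Lemma hyperedge_charge y : 1 < hdeg y ->
  6 * n - 2 + 2 * n * #|goods y| <= \sum_(x in nbhd e y :&: U) wY x y.
Proof.
move=> y2; have [yM|yM] := ltnP M (hdeg y).
  have : {in nbhd e y :&: U, forall x, 2 <= wY x y} by move=> x _; rewrite /wY yM.
  move=> /leq_sum_const; rewrite -/(hdeg y).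
  have [->|[x xg]] := set_0Vmem (goods y); first by rewrite cards0; move: yM; rewrite /M; lia.
  have := goods_hdeg xg; have := few_goods y; move: k_large; rewrite /M.
  nia.
have -> : goods y = set0.
  have [//|[x /goods_hdeg]] := set_0Vmem (goods y); move: k_large; lia.
rewrite cards0 muln0 addn0.
have w2n x : 2 * n <= wY x y.
  by rewrite /wY ltnNge yM /=; repeat case: ifP => _; lia.
have [ylow|] := boolP (low y).
  have : {in nbhd e y :&: U, forall x, 3 * n - 1 <= wY x y}.
    by move=> x _; rewrite /wY ltnNge yM ylow /=; case: ifP; lia.
  by move=> /leq_sum_const; rewrite -/(hdeg y); case/andP: ylow => /eqP ->; lia.
rewrite negb_and => /orP [y3|].
  have : {in nbhd e y :&: U, forall x, 2 * n <= wY x y} by move=> x _.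
  by move=> /leq_sum_const; rewrite -/(hdeg y); nia.
case/forallPn=> p; rewrite negb_imply -ltnNge => /andP [pY pM].
rewrite (big_setD1 p) //=.
have -> : wY p y = 4 * n - 2 by rewrite /wY ltnNge yM pM.
have : {in (nbhd e y :&: U) :\ p, forall x, 2 * n <= wY x y} by move=> x _.
move=> /leq_sum_const; have := cardsD1 p (nbhd e y :&: U); rewrite pY.
by move: y2; rewrite /hdeg; nia.
Qed.

(** Adding all charges, the [2 * n] granted to each good vertex is covered by the hyperedges. Hence
    [4 * n] per incidence amounts to at least [6 * n - 2] per element of [U] and [Ys], contradicting
    [dens]. *)
Lemma discharging_absurd : False.
Proof.
pose Ys := [set y | 1 < hdeg y].
have sX : \sum_(x in U) (6 * n - 2) <=
    \sum_(x in U) (\sum_(y in Yx x) wX x y + 2 * n * (x \in G)).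
  by apply: leq_sum => x; apply: vertex_charge.
have sY : \sum_(y in Ys) (6 * n - 2 + 2 * n * #|goods y|) <=
    \sum_(y in Ys) \sum_(x in nbhd e y :&: U) wY x y.
  by apply: leq_sum => y; rewrite inE; apply: hyperedge_charge.
have swap : \sum_(x in U) \sum_(y in Yx x) wX x y =
            \sum_(y in Ys) \sum_(x in nbhd e y :&: U) wX x y.
  rewrite (exchange_big_dep (mem Ys)) /=; last by move=> x y _; rewrite !inE => /andP [].
  apply: eq_bigr => y yY; apply: eq_bigl => x; move: yY.
  by rewrite !inE => ->; rewrite andbT andbC e_sym.
have tot : \sum_(y in Ys) \sum_(x in nbhd e y :&: U) wX x y +
           \sum_(y in Ys) \sum_(x in nbhd e y :&: U) wY x y =
           4 * n * \sum_(y in Ys) #|nbhd e y :&: U|.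
  rewrite -big_split big_distrr /=; apply: eq_bigr => y _.
  rewrite -big_split /= mulnC -sum_nat_const; apply: eq_bigr => x _.
  rewrite /wX subnK // /wY; repeat case: ifP => _; lia.
have goodsG : \sum_(x in U) (x \in G : nat) <= \sum_(y in Ys) #|goods y|.
  apply: (@leq_trans #|G|).
    rewrite -sum1_card [leqRHS]big_mkcond /= [leqLHS]big_mkcond /=.
    by apply: leq_sum => x _; case: ifP; case: (x \in G).
  apply: (@leq_trans #|\bigcup_(y in Ys) goods y|); last exact: card_bigcup_leq.
  apply/subset_leq_card/bigcupsP=> y _; apply/subsetP=> x xg; apply/bigcupP.
  exists y => //; rewrite inE; have := goods_hdeg xg; move: k_large; rewrite /M; lia.
have := dens Ys; move: sX sY; rewrite !big_split /= swap -!big_distrr /= !sum_nat_const.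
rewrite -/Ys; nia.
Qed.

End Discharging.

(** * Coloring the last two vertices of a block; alternating labels *)

(* With lists of size [k] and [k - 2] colors already used around, this is the only obstruction to
   coloring the last two vertices of a block: see [two_list_colors]. *)
Definition clash (l l' : seq nat) (c c' : nat) : bool :=
  [&& c \in l, c' \in l' & perm_eq (rem c l) (rem c' l')].

Lemma clash_sym l l' c c' : clash l l' c c' = clash l' l c' c.
Proof. by rewrite /clash perm_sym; case: (c \in l); case: (c' \in l'). Qed.

(** This is why avoiding a clash costs the parent colored later only one color. *)
Lemma clash_inj l l' c1 c2 c' :
  uniq l -> clash l l' c1 c' -> clash l l' c2 c' -> c1 = c2.
Proof.
move=> ul /and3P [c1l _ p1] /and3P [c2l _ p2]; apply/eqP; apply: contraT => ne.
have /perm_mem/(_ c1) : perm_eq (rem c1 l) (rem c2 l).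
  by apply: perm_trans p1 _; rewrite perm_sym.
by rewrite !mem_rem_uniq // !inE eqxx ne c1l.
Qed.

Lemma uniq_exists_notin (A F : seq nat) :
  uniq A -> size F < size A -> exists2 c, c \in A & c \notin F.
Proof.
move=> uA lt; have [/hasP [c cA cF]|/hasPn none] := boolP (has [predC F] A).
  by exists c.
suff : size A <= size F by lia.
by apply: uniq_leq_size => // c /none /=; rewrite negbK.
Qed.

(** Each list has a color outside [F]. If distinct ones cannot be chosen, both lists lie in
    [c :: F], which has at most [k] entries, so both have exactly its elements. *)
Lemma two_list_colors (k : nat) (A A' F : seq nat) :
  uniq A -> uniq A' -> k <= size A -> k <= size A' -> size F < k ->
  ~~ ((size A == k) && perm_eq A A') ->
  exists c c', [/\ c \in A, c' \in A', c \notin F, c' \notin F & c != c'].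
Proof.
move=> uA uA' kA kA' Fk nperm.
have [c cA cF] := uniq_exists_notin uA (leq_trans Fk kA).
have [c' cA' cF'] := uniq_exists_notin uA' (leq_trans Fk kA').
have [E|ne] := eqVneq c c'; last by exists c, c'.
subst c'.
have [/hasP [d dA /andP [/= dF dc]]|/hasPn h] :=
  boolP (has (fun d => (d \notin F) && (d != c)) A); first by exists d, c.
have [/hasP [d dA /andP [/= dF dc]]|/hasPn h'] :=
  boolP (has (fun d => (d \notin F) && (d != c)) A').
  by exists c, d; rewrite eq_sym.
have sub (B : seq nat) : {in B, forall d, ~~ ((d \notin F) && (d != c))} -> {subset B <= c :: F}.
  move=> hB d /hB; rewrite negb_and !negbK inE; case: (d == c) => //=.
  by rewrite orbF.
have [eA sA] := uniq_min_size uA (sub _ h) (leq_trans Fk kA).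
have [_ sA'] := uniq_min_size uA' (sub _ h') (leq_trans Fk kA').
case/negP: nperm; apply/andP; split; first by rewrite /= in eA; lia.
by apply: uniq_perm => // d; rewrite sA sA'.
Qed.

(** Increasing times make [pr] a forest; the labels are assigned from the latest time downwards. *)
Lemma exists_alternating (T : finType) (time : T -> nat) (pr : T -> option T) :
  (forall z p, pr z = Some p -> time z < time p) ->
  exists par : T -> bool, forall z p, pr z = Some p -> par z = ~~ par p.
Proof.
move=> up; pose m := \max_x time x.
have le_m x : time x <= m by apply: leq_bigmax.
suff h j : exists par : T -> bool, forall z p,
    pr z = Some p -> m < time z + j -> par z = ~~ par p.
  by have [par parP] := h m.+1; exists par => z p zp; apply: parP => //; lia.
elim: j => [|j [par parP]].
  by exists (fun=> true) => z p _; have := le_m z; lia.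
exists (fun z => if m < time z + j then par z else
                 if pr z is Some p then ~~ par p else true) => z p zp lt.
rewrite zp (_ : m < time p + j); last by have := up _ _ zp; lia.
by case: ifP => // /(parP _ _ zp).
Qed.

(** * The peeling order *)

Section Coloring.
Variables (T : finType) (e : rel T).
Hypothesis e_sym : symmetric e.
Variables (k M N : nat).
Hypothesis deg_le : forall y, #|nbhd e y| <= k.
Hypothesis N_large : 2 * (M.+1 * M.+1) <= N.
Implicit Types (U V : {set T}) (x y z p : T).

Definition peel_step U B (c : option T) : Prop :=
  if c is Some y then B = block e U M y /\ N <= #|goods e U M y|
  else exists x, [/\ x \in U, B = [set x] & #|conf e x :&: U| + 1 < k].

Lemma goods_block U y : goods e U M y \subset block e U M y.
Proof. by apply/subsetP=> z; rewrite inE => /andP []. Qed.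

Lemma block_sub U y : block e U M y \subset U.
Proof. by apply/subsetP=> z; rewrite inE => /andP []. Qed.

(** The piece removed first gets time 0, and the times of the remaining vertices are shifted by one.
    Large times are colored first. *)
Lemma peeling_exists :
  (forall U, U != set0 -> (exists2 x, x \in U & #|conf e x :&: U| + 1 < k) \/
                          (exists y, N <= #|goods e U M y|)) ->
  forall U, exists (time : T -> nat) (ctr : nat -> option T), forall t,
  [set x in U | t <= time x] != set0 ->
  peel_step [set x in U | t <= time x] [set x in U | time x == t] (ctr t).
Proof.
move=> reducible U; have [m] := ubnP #|U|; elim: m U => // m IHm U ltU.
have [->|U0] := eqVneq U set0.
  exists (fun=> 0), (fun=> None) => t /set0Pn [x]; by rewrite !inE.
have [B [c [BU B0 stepB]]] : exists (B : {set T}) c, [/\ B \subset U, B != set0 & peel_step U B c].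
  have [[x xU xk]|[y yN]] := reducible _ U0.
    exists [set x], None; split; first by rewrite sub1set.
      by apply/set0Pn; exists x; rewrite set11.
    by exists x.
  exists (block e U M y), (Some y); split=> //; first exact: block_sub.
  rewrite -card_gt0; apply: leq_trans (subset_leq_card (goods_block U y)).
  by apply: leq_trans yN; apply: leq_trans N_large.
have [|time [ctr H]] := IHm (U :\: B).
  have := cardsID B U; rewrite (setIidPr BU); have : 0 < #|B| by rewrite card_gt0.
  by lia.
exists (fun x => if x \in B then 0 else (time x).+1),
       (fun t => if t is t'.+1 then ctr t' else c) => -[|t] /=.
  have -> : [set x in U | 0 <= (if x \in B then 0 else (time x).+1)] = U.
    by apply/setP=> x; rewrite !inE andbT.
  have -> // : [set x in U | (if x \in B then 0 else (time x).+1) == 0] = B.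
    by apply/setP=> x; rewrite !inE; case: ifP; rewrite ?andbF ?andbT // => /(subsetP BU).
have -> : [set x in U | t < (if x \in B then 0 else (time x).+1)] =
          [set x in U :\: B | t <= time x].
  by apply/setP=> x; rewrite !inE; case: ifP; rewrite ?andbF.
have -> : [set x in U | (if x \in B then 0 else (time x).+1) == t.+1] =
          [set x in U :\: B | time x == t].
  by apply/setP=> x; rewrite !inE; case: ifP; rewrite ?andbF.
exact: H.
Qed.

(** * Parents and the selection of pairs *)

Section Fixed_peeling.
Variables (time : T -> nat) (ctr : nat -> option T).
(* Layer [t] is peeled off level [t]: it is a block around [y] if [ctr t = Some y], and a single
   vertex if [ctr t = None]. *)
Definition level t : {set T} := [set x | t <= time x].
Definition layer t : {set T} := [set x | time x == t].
Hypothesis peelP : forall t, level t != set0 -> peel_step (level t) (layer t) (ctr t).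

Definition candidates : {set T} :=
  [set z | if ctr (time z) is Some y then z \in goods e (level (time z)) M y else false].

(** For a candidate the set picked from has at most one element. *)
Definition parent z : option T :=
  if ctr (time z) is Some y then
    [pick p in (conf e z :&: level (time z)) :\: nbhd e y] else None.

Lemma level_self z : level (time z) != set0.
Proof. by apply/set0Pn; exists z; rewrite inE. Qed.

Lemma parentP z p : parent z = Some p -> exists2 y, ctr (time z) = Some y &
  p \in (conf e z :&: level (time z)) :\: nbhd e y.
Proof.
rewrite /parent; case: (ctr _) => // y; case: pickP => // q qP [<-].
by exists y.
Qed.

(** The layer of [z] is a block inside the neighborhood of its center, and the parent lies outside
    that neighborhood. Parents are therefore colored before their children. *)
Lemma parent_time z p : parent z = Some p -> time z < time p.
Proof.
move=> /parentP [y cy]; rewrite !inE => /and3P [py _ le].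
rewrite ltn_neqAle le andbT; apply: contra py => E.
have := peelP (level_self z); rewrite cy => -[EB _].
have : p \in layer (time z) by rewrite inE eq_sym.
by rewrite EB => /blockP [].
Qed.

Lemma candidate_conf z y : z \in candidates -> ctr (time z) = Some y ->
  forall w, w \in conf e z -> w \in level (time z) -> e y w \/ parent z = Some w.
Proof.
rewrite inE => zc cy w wc wl; move: zc; rewrite cy inE => /and3P [_ le1 _].
case: (boolP (e y w)) => [|yw]; [by left|right].
have wP : w \in (conf e z :&: level (time z)) :\: nbhd e y.
  by rewrite in_setD in_setI wc wl inE yw.
rewrite /parent cy; case: pickP => [q qP|/(_ w)]; last by rewrite wP.
by rewrite (card_le1_eqP le1 _ _ wP qP).
Qed.

(** Each child [z] has a hyperedge [h z] that meets its level in just [z] and [v], so distinct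
    children have distinct hyperedges. At the level of the earliest child all of them count towards
    [vdeg] of [v]. *)
Lemma card_children v : #|[set z in candidates | parent z == Some v]| <= M.
Proof.
pose Ch := [set z in candidates | parent z == Some v].
have chP z : z \in Ch -> (vdeg e (level (time z)) v <= M) /\
    exists y', nbhd e y' :&: level (time z) = [set z; v].
  rewrite inE => /andP [zc /eqP zv]; have [y cy vP] := parentP zv.
  move: zc; rewrite inE cy inE => /and3P [_ _ /forallP/(_ v)].
  by rewrite vP /= => /andP [-> /existsP [y' /eqP]]; split=> //; exists y'.
have chv z : z \in Ch -> z != v.
  rewrite inE => /andP [_ /eqP/parent_time]; apply: contraTneq => ->.
  by rewrite ltnn.
rewrite -/Ch; have [->|[z0 z0C]] := set_0Vmem Ch; first by rewrite cards0.
have [z1 z1C z1min] := arg_minnP time z0C.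
pose h z := odflt z [pick y' | nbhd e y' :&: level (time z) == [set z; v]].
have hP z : z \in Ch -> nbhd e (h z) :&: level (time z) = [set z; v].
  move=> /chP [_ [y' E]]; rewrite /h; case: pickP => [y'' /eqP //|/(_ y')].
  by rewrite E eqxx.
have hin z w : z \in Ch -> w \in Ch -> time z <= time w -> h z = h w -> z = w.
  move=> zC wC le E; have : w \in nbhd e (h z) :&: level (time z).
    have : w \in nbhd e (h w) :&: level (time w) by rewrite hP // !inE eqxx.
    by rewrite E !inE le => /andP [-> _].
  by rewrite hP // !inE (negPf (chv _ wC)) orbF => /eqP.
have hinj : {in Ch &, injective h}.
  move=> z w zC wC E; case/orP: (leq_total (time z) (time w)) => le.
    exact: hin E.
  by apply/esym; apply: hin (esym E).
rewrite -(card_in_imset hinj); apply: leq_trans (chP _ z1C).1.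
apply/subset_leq_card/subsetP=> y' /imsetP [z zC ->]; rewrite inE.
have sub : [set z; v] \subset nbhd e (h z) :&: level (time z1).
  rewrite -(hP _ zC); apply: setIS; apply/subsetP=> x; rewrite !inE.
  exact/leq_trans/z1min.
apply/andP; split.
  have : v \in [set z; v] by rewrite !inE eqxx orbT.
  by move=> /(subsetP sub); rewrite !inE e_sym => /andP [].
by apply: leq_trans (subset_leq_card sub); rewrite cards2 chv.
Qed.

(** [tok b] sends a vertex of label [b] to itself and any other to its parent, if it has one.
    Siblings, and likewise a parent and its child, share a token for the label of the parent, so
    injectivity for both labels gives the last two properties. *)
Lemma selection_exists : exists R : {set T},
  [/\ R \subset candidates,
      forall t y, level t != set0 -> ctr t = Some y -> 1 < #|R :&: layer t|,
      forall z w p, z \in R -> w \in R -> parent z = Some p -> parent w = Some p -> z = w &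
      forall z w, z \in R -> w \in R -> parent z <> Some w].
Proof.
have [par parP] := exists_alternating parent_time.
pose m := \max_x time x.
have le_m x : time x <= m by apply: leq_bigmax.
pose key x : 'I_m.+1 := inord (time x).
have keyE x i : (key x == i) = (time x == i).
  by rewrite -val_eqE /= inordK // ltnS.
pose J := [set i : 'I_m.+1 | (level i != set0) && (ctr i != None)].
(* Blocks centred at the vertices of parity [b]: a vertex together with its children. *)
pose tok (b : bool) z := if par z == b then z else odflt z (parent z).
have fib (R : {set T}) b v : R \subset candidates -> #|[set z in R | tok b z == v]| <= M.+1.
  move=> RC; apply: (@leq_trans #|v |: [set z in candidates | parent z == Some v]|).
    apply/subset_leq_card/subsetP=> z; rewrite !inE => /andP [zR].
    rewrite /tok; case: ifP => _; first by move=> ->.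
    case E: (parent z) => [p|] /=; last by move=> ->.
    by move=> /eqP pv; have := subsetP RC _ zR; rewrite inE => ->; rewrite pv eqxx orbT.
  rewrite cardsU1; have := card_children v; case: (v \notin _) => /=; lia.
(* Each of the two selections divides the supply by [M.+1], the size of a fibre; two vertices per
   block must survive, whence [N_large]. *)
have [//|||R1 [R1C inj1 big1]] := @select_distinct_tokens _ _ _ key (tok true) J candidates
  M.+1 (M.+1 * 2).
- by move=> v; apply: fib.
- move=> i; rewrite inE => /andP [i0 ci].
  have := peelP i0; case cy: (ctr i) ci => [y|] // _ [_ Ny].
  apply: (@leq_trans N); first by rewrite mulnA mulnC.
  apply: leq_trans Ny _; apply/subset_leq_card/subsetP=> z zg.
  have zi : time z == i.
    have := peelP i0; rewrite cy => -[EB _].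
    by have := subsetP (goods_block _ _) _ zg; rewrite -EB inE.
  by rewrite !inE keyE zi andbT (eqP zi) cy.
have [//|||R2 [R2R1 inj2 big2]] := @select_distinct_tokens _ _ _ key (tok false) J R1 M.+1 2.
- by move=> v; apply: fib.
- exact: big1.
have tok_inj b : {in R2 &, injective (tok b)}.
  case: b => // z w zR wR; apply: inj1; exact: (subsetP R2R1).
exists R2; split.
- exact: subset_trans R1C.
- move=> t y t0 cy; have tm : t < m.+1.
    by case/set0Pn: (t0) => x; rewrite inE => /leq_trans h; rewrite ltnS h.
  have := big2 (Ordinal tm); rewrite inE /= t0 cy => /(_ isT) h.
  apply: leq_trans h _; apply/subset_leq_card/subsetP=> z.
  by rewrite !inE keyE.
- move=> z w p zR wR zp wp; apply: (tok_inj (par p)) => //.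
  by rewrite /tok (parP _ _ zp) (parP _ _ wp) zp wp; case: (par p).
move=> z w zR wR zw; have := parent_time zw.
suff -> : z = w by rewrite ltnn.
apply: (tok_inj (par w)) => //.
by rewrite /tok eqxx (parP _ _ zw) zw; case: (par w).
Qed.

(** * Extending the coloring layer by layer *)

Section Fixed_pairs.
Variable P : {set T * T}.
Let sel : {set T} := [set z | [exists u in P, (z == u.1) || (z == u.2)]].
Hypothesis P_cand : sel \subset candidates.
Hypothesis P_neq : forall u, u \in P -> u.1 != u.2.
Hypothesis P_time : forall u, u \in P -> time u.2 = time u.1.
Hypothesis P_inj : forall u v, u \in P -> v \in P -> time u.1 = time v.1 -> u = v.
Hypothesis P_ex : forall t y, level t != set0 -> ctr t = Some y ->
  exists2 u, u \in P & time u.1 = t.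
Hypothesis sel_inj : forall z w p, z \in sel -> w \in sel ->
  parent z = Some p -> parent w = Some p -> z = w.
Hypothesis sel_indep : forall z w, z \in sel -> w \in sel -> parent z <> Some w.

Variable L : T -> seq nat.
Hypothesis L_list : list_assignment k L.

Definition pair_ok V (phi : T -> nat) (u : T * T) : bool :=
  match parent u.1, parent u.2 with
  | Some p, Some q => (p \in V) && (q \in V) ==> ~~ clash (L u.1) (L u.2) (phi p) (phi q)
  | _, _ => true
  end.

Definition valid V (phi : T -> nat) : Prop :=
  [/\ {in V, forall x, phi x \in L x},
      {in V &, forall x y, x \in conf e y -> phi x != phi y} &
      {in P, forall u, pair_ok V phi u}].

Definition update (phi : T -> nat) x c : T -> nat := fun w => if w == x then c else phi w.

Lemma L_uniq x : uniq (L x). Proof. by have [] := L_list x. Qed.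
Lemma size_L x : size (L x) = k. Proof. by have [] := L_list x. Qed.

Lemma conf_sym x y : (x \in conf e y) = (y \in conf e x).
Proof.
rewrite !inE eq_sym; congr andb.
by apply/existsP/existsP=> -[w /andP [a b]]; exists w; rewrite a b.
Qed.

Lemma conf_irr x : x \notin conf e x.
Proof. by rewrite inE eqxx. Qed.

Lemma sel1 u : u \in P -> u.1 \in sel.
Proof. by move=> uP; rewrite inE; apply/existsP; exists u; rewrite uP eqxx. Qed.
Lemma sel2 u : u \in P -> u.2 \in sel.
Proof. by move=> uP; rewrite inE; apply/existsP; exists u; rewrite uP eqxx orbT. Qed.

Definition mates z w := ((z, w) \in P) || ((w, z) \in P).

Lemma mates_sel z w : mates z w -> z \in sel.
Proof. by case/orP=> [/sel1|/sel2]. Qed.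

Lemma mates_fun z w w' : mates z w -> mates z w' -> w = w'.
Proof.
have tm a b : mates a b -> time b = time a.
  by case/orP=> /P_time /= ->.
move=> m m'; have E := tm _ _ m; have E' := tm _ _ m'.
case/orP: m => m; case/orP: m' => m'.
- by have /= := P_inj m m' erefl; case.
- by have /= := P_inj m m' (esym E'); case=> <- ->.
- by have /= := P_inj m m' E; case=> -> <-.
- by have /= := P_inj m m' (etrans E (esym E')); case.
Qed.

(** Only a pair with parent [x] can turn bad. Its two parents differ by [sel_inj], so the other one
    keeps its color under [update]. *)
Lemma pair_okPn V phi x c : x \notin V -> {in P, forall u, pair_ok V phi u} ->
  ~~ [forall u in P, pair_ok (x |: V) (update phi x c) u] ->
  exists z w q, [/\ mates z w, parent z = Some x, parent w = Some q &
                    clash (L z) (L w) c (phi q)].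
Proof.
move=> xV ok /forallPn [[z w]]; rewrite negb_imply => /andP [uP].
have := ok _ uP; rewrite /pair_ok /=.
case zp: (parent z) => [p|] //; case wq: (parent w) => [q|] // okV.
rewrite negb_imply negbK => /andP [/andP [pV qV] cl].
have pq : p != q.
  apply: contraNneq (P_neq uP) => E /=; apply/eqP.
  by apply: (sel_inj (sel1 uP) (sel2 uP) zp); rewrite wq E.
move: pV qV cl; rewrite !inE /update.
have [Ep|px] /= := eqVneq p x; have [Eq|qx] /= := eqVneq q x.
- by rewrite Ep Eq eqxx in pq.
- move=> _ _ cl; exists z, w, q; rewrite -Ep; split=> //; by rewrite /mates uP.
- move=> _ _ cl; exists w, z, p; rewrite -Eq; split=> //; first by rewrite /mates uP orbT.
  by rewrite clash_sym.
- by move=> pV qV cl; rewrite pV qV cl in okV.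
Qed.

(** Two colors of [L x] avoid all conflicts. If both broke a pair, it would be the same pair, since
    [x] is the parent of at most one selected vertex; this contradicts [clash_inj]. *)
Lemma extend_one V phi x : valid V phi -> x \notin V -> #|conf e x :&: V| + 1 < k ->
  exists phi', valid (x |: V) phi'.
Proof.
move=> [vL vC vP] xV cxV.
pose F := [seq phi u | u <- enum (conf e x :&: V)].
have sF : size F = #|conf e x :&: V| by rewrite size_map -cardE.
have [|c1 c1L c1F] := @uniq_exists_notin (L x) F (L_uniq x).
  by rewrite size_L sF; lia.
have [|c2 c2L] := @uniq_exists_notin (L x) (c1 :: F) (L_uniq x).
  by rewrite /= size_L sF; lia.
rewrite inE negb_or => /andP [c21 c2F].
have good c : c \in L x -> c \notin F ->
    [forall u in P, pair_ok (x |: V) (update phi x c) u] -> valid (x |: V) (update phi x c).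
  move=> cL cF /forallP okP.
  have cphi w : w \in V -> w \in conf e x -> phi w != c.
    move=> wV wx; apply: contraNneq cF => <-; apply: map_f.
    by rewrite mem_enum inE wx wV.
  split.
  - by move=> w; rewrite !inE /update; case: eqVneq => [->|_] //=; apply: vL.
  - move=> w v; rewrite !in_setU1 /update; case: (eqVneq w x) => [->|wx] /=;
      case: (eqVneq v x) => [->|vx] //= wV vV h.
    + by rewrite (negPf (conf_irr x)) in h.
    + by rewrite eq_sym; apply: cphi; rewrite // conf_sym.
    + exact: cphi.
    + exact: vC.
  - by move=> u uP; have := okP u; rewrite uP.
have [ok1|/(pair_okPn xV vP) [z [w [q [m zx wq cl1]]]]] :=
  boolP [forall u in P, pair_ok (x |: V) (update phi x c1) u].
  by exists (update phi x c1); apply: good.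
have [ok2|/(pair_okPn xV vP) [z' [w' [q' [m' zx' wq' cl2]]]]] :=
  boolP [forall u in P, pair_ok (x |: V) (update phi x c2) u].
  by exists (update phi x c2); apply: good.
have E := sel_inj (mates_sel m) (mates_sel m') zx zx'; subst z'.
have E := mates_fun m m'; subst w'.
move: wq' cl2; rewrite wq => -[<-] cl2.
by rewrite (clash_inj (L_uniq z) cl1 cl2) eqxx in c21.
Qed.

Lemma extend_set V (D : {set T}) phi : valid V phi ->
  {in D, forall x, #|conf e x :&: (V :|: D)| + 1 < k} -> exists phi', valid (V :|: D) phi'.
Proof.
have [m] := ubnP #|D|; elim: m D phi => // m IHm D phi ltD vV small.
have [->|[x xD]] := set_0Vmem D; first by exists phi; rewrite setU0.
have DE : V :|: D = x |: (V :|: D :\ x).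
  by rewrite setUCA setD1K.
have [||phi1 v1] := IHm (D :\ x) phi _ vV.
- by have := cardsD1 x D; rewrite xD; lia.
- move=> w; rewrite !inE => /andP [_ wD]; apply: leq_ltn_trans (small _ wD).
  by rewrite leq_add2r; apply/subset_leq_card/setIS/setUS/subD1set.
rewrite DE; have [xV|xV] := boolP (x \in V :|: D :\ x).
  by exists phi1; rewrite (setUidPr _) // sub1set.
apply: extend_one v1 xV _; apply: leq_ltn_trans (small _ xD).
by rewrite leq_add2r; apply/subset_leq_card/setIS/setUS/subD1set.
Qed.

Definition avail (phi : T -> nat) z : seq nat :=
  if parent z is Some p then rem (phi p) (L z) else L z.

Lemma avail_uniq phi z : uniq (avail phi z).
Proof. by rewrite /avail; case: (parent z) => [p|]; rewrite ?rem_uniq ?L_uniq. Qed.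

Lemma avail_sub phi z c : c \in avail phi z -> c \in L z.
Proof. by rewrite /avail; case: (parent z) => // p /mem_rem. Qed.

Lemma size_avail phi z : k.-1 <= size (avail phi z).
Proof.
rewrite /avail; case: (parent z) => [p|]; last by rewrite size_L leq_pred.
have [pL|pL] := boolP (phi p \in L z); first by rewrite size_rem // size_L.
by rewrite rem_id // size_L leq_pred.
Qed.

Lemma avail_tight phi z : 0 < k -> size (avail phi z) = k.-1 ->
  exists2 p, parent z = Some p & phi p \in L z.
Proof.
rewrite /avail; case: (parent z) => [p|] k0; last by rewrite size_L; lia.
by case: (boolP (phi p \in L z)) => [pL|pL]; [exists p|rewrite rem_id // size_L; lia].
Qed.

(** At most [k - 2] colors are used around [y], and each of the two vertices has at least [k - 1]
    colors differing from that of its parent, so [two_list_colors] applies with [k.-1]. *)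
Lemma extend_pair t y u phi : ctr t = Some y -> u \in P -> time u.1 = t ->
  [set u.1; u.2] \subset nbhd e y ->
  valid (level t :\: [set u.1; u.2]) phi -> exists phi', valid (level t) phi'.
Proof.
case: u => z z' cy uP /= tz sub [vL vC vP].
have tz' : time z' = t by rewrite -tz; apply: P_time uP.
have zz' : z != z' by apply: P_neq uP.
have zsel := sel1 uP; have z'sel := sel2 uP; rewrite /= in zsel z'sel.
have zl : z \in level t by rewrite inE tz.
have zl' : z' \in level t by rewrite inE tz'.
set V := level t :\: [set z; z'] in vL vC vP *.
have cardV : #|nbhd e y :&: V| <= k - 2.
  have c2 : #|[set z; z']| = 2 by rewrite cards2 zz'.
  have : nbhd e y :&: V \subset nbhd e y :\: [set z; z'].
    by apply/subsetP=> x; rewrite !inE => /and3P [-> -> _].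
  move=> /subset_leq_card; have := cardsID [set z; z'] (nbhd e y).
  by rewrite (setIidPr sub) c2; have := deg_le y; lia.
have k2 : 1 < k.
  apply: leq_trans (deg_le y); apply: leq_trans (subset_leq_card sub).
  by rewrite cards2 zz'.
have parV w p : w \in sel -> time w = t -> parent w = Some p -> p \in V.
  move=> ws tw wp; have := parent_time wp.
  rewrite tw !inE negb_or => lt; rewrite (ltnW lt) andbT.
  by apply/andP; split; apply/negP=> /eqP E; rewrite E ?tz ?tz' ltnn in lt.
pose F := [seq phi w | w <- enum (nbhd e y :&: V)].
have sF : size F < k.-1.
  by rewrite size_map -cardE; lia.
have [|c [c' [cA cA' cF cF' cc']]] := @two_list_colors k.-1 (avail phi z) (avail phi z') F
   (avail_uniq _ _) (avail_uniq _ _) (size_avail _ _) (size_avail _ _) sF.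
  (* In the obstruction both lists lose a color to a parent and then coincide: the clash excluded by
     [pair_ok]. *)
  apply/negP=> /andP [/eqP sA pA].
  have sA' : size (avail phi z') = k.-1 by rewrite -sA; apply/esym/perm_size.
  have [p zp pL] := avail_tight (ltnW k2) sA.
  have [p' zp' pL'] := avail_tight (ltnW k2) sA'.
  have := vP _ uP; rewrite /pair_ok /= zp zp' (parV z p) // (parV z' p') //=.
  by rewrite /clash pL pL'; move: pA; rewrite /avail zp zp' => ->.
pose phi' := update (update phi z' c') z c.
have phiV w : w \in V -> phi' w = phi w.
  by rewrite !inE negb_or /phi' /update => /andP [/andP [/negPf -> /negPf ->]].
have phiz : phi' z = c by rewrite /phi' /update eqxx.
have phiz' : phi' z' = c' by rewrite /phi' /update eq_sym (negPf zz') eqxx.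
have levelE w : w \in level t -> [\/ w = z, w = z' | w \in V].
  move=> wl; rewrite /V in_setD wl andbT !inE.
  case: eqVneq => [->|_]; first by constructor 1.
  by case: eqVneq => [->|_]; [constructor 2|constructor 3].
have far w d v : w \in sel -> time w = t -> d \in avail phi w -> d \notin F -> v \in V ->
    v \in conf e w -> d != phi v.
  move=> ws tw dA dF vV vw; have vl : v \in level (time w).
    by move: vV; rewrite tw inE => /andP [].
  have cw : ctr (time w) = Some y by rewrite tw.
  have [yv|wv] := candidate_conf (subsetP P_cand _ ws) cw vw vl.
    by apply: contraNneq dF => ->; apply: map_f; rewrite mem_enum inE vV inE yv.
  by move: dA; rewrite /avail wv mem_rem_uniq ?L_uniq // inE => /andP [].
exists phi'; split.
- move=> w /levelE [->|->|wV]; first by rewrite phiz (avail_sub cA).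
    by rewrite phiz' (avail_sub cA').
  by rewrite phiV // vL.
- move=> w v /levelE [->|->|wV] /levelE [->|->|vV] h; rewrite ?phiz ?phiz' ?phiV //.
  + by rewrite (negPf (conf_irr _)) in h.
  + by apply: (far z); rewrite // conf_sym.
  + by rewrite eq_sym.
  + by rewrite (negPf (conf_irr _)) in h.
  + by apply: (far z'); rewrite // conf_sym.
  + by rewrite eq_sym; apply: (far z).
  + by rewrite eq_sym; apply: (far z').
  + exact: vC.
- move=> [a b] abP; have := vP _ abP; rewrite /pair_ok /=.
  case pa: (parent a) => [p|] //; case pb: (parent b) => [q|] // ok.
  (* Parents are never selected, so coloring the pair changes no color of a parent. *)
  have inV s w : s \in sel -> parent s = Some w -> w \in level t -> w \in V.
    by move=> ss sw /levelE [E|E|//]; subst w; case: (sel_indep ss _ sw).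
  apply/implyP=> /andP [pl ql].
  have pV := inV _ _ (sel1 abP) pa pl; have qV := inV _ _ (sel2 abP) pb ql.
  by rewrite !phiV //; move: ok; rewrite pV qV.
Qed.

(** A block is colored in three rounds: its vertices outside [Z], then [Z] without the pair, then
    the pair. *)
Lemma extend_level t phi : valid (level t.+1) phi -> exists phi', valid (level t) phi'.
Proof.
move=> v1; have lE : level t = level t.+1 :|: layer t.
  by apply/setP=> x; rewrite !inE leq_eqVlt orbC eq_sym.
have [l0|l0] := eqVneq (level t) set0.
  exists phi; rewrite l0; split=> [x|x y|u uP]; rewrite ?inE //.
  by rewrite /pair_ok; do 2 case: (parent _) => [?|] //; rewrite inE.
have := peelP l0; case cy: (ctr t) => [y|]; last first.
  case=> x [_ Ex cx]; rewrite lE; apply: extend_set v1 _ => w.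
  by rewrite Ex inE => /eqP ->; rewrite -Ex -lE.
case=> EB NZ; set Z := goods e (level t) M y in NZ.
have ZB : Z \subset layer t by rewrite EB; apply: goods_block.
have Zy : Z \subset nbhd e y.
  by apply/subsetP=> z /(subsetP ZB); rewrite EB => /blockP [_ yz _ _]; rewrite inE.
have [u uP ut] := P_ex l0 cy.
have uZ w : w \in sel -> time w = t -> w \in Z.
  by move=> /(subsetP P_cand); rewrite inE => + tw; rewrite tw cy.
have EZ : [set u.1; u.2] \subset Z.
  by rewrite subUset !sub1set !uZ ?sel1 ?sel2 ?P_time.
have c2 : #|[set u.1; u.2]| = 2 by rewrite cards2 P_neq.
have E1 : level t.+1 :|: (layer t :\: Z) = level t :\: Z.
  apply/setP=> x; rewrite lE in_setU !in_setD in_setU.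
  case: (boolP (x \in Z)) => //= xZ; have := subsetP ZB _ xZ.
  by rewrite !inE => /eqP ->; rewrite ltnn.
have E2 : (level t :\: Z) :|: (Z :\: [set u.1; u.2]) = level t :\: [set u.1; u.2].
  apply/setP=> x; rewrite in_setU !in_setD; case: (boolP (x \in Z)) => xZ /=.
    by have := subsetP ZB _ xZ; rewrite !inE => /eqP ->; rewrite leqnn.
  by rewrite andbF orbF (contraNN (subsetP EZ x)).
(* While the [N] or more vertices of [Z] are uncolored, they outweigh the [M * M] conflicts away
   from [y]. *)
have [|phi1 v2] := extend_set (D := layer t :\: Z) v1.
  move=> x; rewrite inE E1 => /andP [xZ]; rewrite EB => /blockP [xl yx xM small].
  have := conf_bound e_sym (subsetDl (level t) Z) xl xM small; rewrite e_sym yx.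
  have := cardsD1 x (nbhd e y :&: (level t :\: Z)); rewrite in_setI in_setD xZ xl inE yx /=.
  have : nbhd e y :&: (level t :\: Z) \subset nbhd e y :\: Z.
    by rewrite setDE setIA -setDE; apply: setSD; apply: subsetIl.
  move=> /subset_leq_card; have := cardsID Z (nbhd e y); rewrite (setIidPr Zy).
  by move: (deg_le y) NZ N_large; clear; lia.
rewrite E1 in v2.
(* The uncolored pair and the vertex itself leave at most [k - 3] conflicts around [y]; the parent
   adds at most one. *)
have [|phi2 v3] := extend_set (D := Z :\: [set u.1; u.2]) v2.
  move=> z; rewrite inE E2 => /andP [zu zZ].
  have := zZ; rewrite inE => /and3P [/blockP [zl yz _ _] le1 _].
  set W := level t :\: [set u.1; u.2].
  have sub : conf e z :&: W \subset ((nbhd e y :\: [set u.1; u.2]) :\ z) :|: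
      ((conf e z :&: level t) :\: nbhd e y).
    apply/subsetP=> w; rewrite in_setI in_setD => /and3P [wz wu wl].
    rewrite in_setU in_setD1 !in_setD wu in_setI wz wl /=.
    have -> : w != z by apply: contraTneq wz => ->; apply: conf_irr.
    by rewrite andbT orbN.
  have := leq_trans (subset_leq_card sub) (leq_card_setU _ _).
  have := cardsD1 z (nbhd e y :\: [set u.1; u.2]); rewrite in_setD zu inE yz /=.
  have := cardsID [set u.1; u.2] (nbhd e y); rewrite (setIidPr (subset_trans EZ Zy)) c2.
  by move: (deg_le y) le1; clear; lia.
rewrite E2 in v3; exact: extend_pair cy uP ut (subset_trans EZ Zy) v3.
Qed.

Lemma coloring_exists : exists c, list_injective_coloring e L c.
Proof.
pose m := \max_x time x.
have le_m x : time x <= m by apply: leq_bigmax.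
have h j : exists phi, valid (level (m.+1 - j)) phi.
  elim: j => [|j [phi v]].
    have E : level (m.+1 - 0) = set0.
      by apply/setP=> x; rewrite !inE subn0 ltnNge le_m.
    exists (fun=> 0); rewrite E; split=> [x|x y|u uP]; rewrite ?inE //.
    by rewrite /pair_ok; do 2 case: (parent _) => [?|] //; rewrite inE.
  have [le|lt] := leqP m.+1 j.
    by exists phi; rewrite (_ : m.+1 - j.+1 = m.+1 - j) //; lia.
  by apply: (@extend_level _ phi); rewrite (_ : (m.+1 - j.+1).+1 = m.+1 - j) //; lia.
have [phi [vL vC _]] := h m.+1; exists phi; rewrite subnn in vL vC; split.
  by move=> v; apply: vL; rewrite inE.
by move=> u v uv cuv; apply: vC; rewrite ?inE // uv.
Qed.

End Fixed_pairs.
End Fixed_peeling.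
End Coloring.

(** * Choice of constants and the final theorem *)

Section Choosability.
Variables (T : finType) (e : rel T).
Hypotheses (e_sym : symmetric e) (e_irr : irreflexive e).

(** These are the least values allowed by [N_large] and [k_large] for [M = 3 * n]. *)
Definition good_bound (n : nat) : nat := 2 * ((3 * n).+1 * (3 * n).+1).
Definition degree_bound (n : nat) : nat := 3 * n * (3 * n) + n * good_bound n + 3 * n + 2.

Lemma sparse_inj_choosable (n k : nat) : 0 < n -> degree_bound n <= k ->
  (forall y, #|nbhd e y| <= k) ->
  (forall S : {set T}, S != set0 ->
     2 * n * #|induced_edges e S| < (3 * n - 1) * #|S|) ->
  inj_choosable e k.
Proof.
move=> n_gt0 kn deg_le dens L L_list; set N := good_bound n; set M := 3 * n.
have reducible (U : {set T}) : U != set0 ->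
    (exists2 x, x \in U & #|conf e x :&: U| + 1 < k) \/ (exists y, N <= #|goods e U M y|).
  move=> U0; have [/existsP [x /andP [xU xk]]|/existsPn no_x] :=
    boolP [exists x, (x \in U) && (#|conf e x :&: U| + 1 < k)]; first by left; exists x.
  have [/existsP [y yN]|/existsPn no_y] := boolP [exists y, N <= #|goods e U M y|].
    by right; exists y.
  case: (@discharging_absurd _ e e_sym e_irr n k N U) => //.
  - by move=> V; apply: density_double_cover.
  - by move=> x xU; have := no_x x; rewrite xU -leqNgt.
  - by move=> y; rewrite ltnNge no_y.
have [time [ctr peel]] := peeling_exists (leqnn N) reducible [set: T].
have peelP t : level time t != set0 -> peel_step e k M N (level time t) (layer time t) (ctr t).
  have := peel t; rewrite /level /layer.
  have -> : [set x in [set: T] | t <= time x] = [set x | t <= time x].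
    by apply/setP=> x; rewrite !inE.
  by have -> : [set x in [set: T] | time x == t] = [set x | time x == t]
    by apply/setP=> x; rewrite !inE.
have [R [RC R2 Rinj Rindep]] := selection_exists e_sym (leqnn N) peelP.
(* At most one pair is picked per time, so a pair in [P] is determined by its time. *)
pose sel t := [pick u : T * T | [&& u.1 != u.2, u.1 \in R, u.2 \in R,
                                 time u.1 == t & time u.2 == t]].
pose P := [set u : T * T | sel (time u.1) == Some u].
have PP u : u \in P -> [/\ u.1 != u.2, u.1 \in R, u.2 \in R & time u.2 = time u.1].
  rewrite inE /sel; case: pickP => // v vP /eqP [E].
  by move: vP; rewrite E => /and5P [-> -> -> _ /eqP].
have selR z : z \in [set z | [exists u in P, (z == u.1) || (z == u.2)]] -> z \in R.
  rewrite inE => /existsP [u /andP [/PP [_ u1 u2 _]]].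
  by case/orP=> /eqP->.
apply: (@coloring_exists _ e e_sym k M N deg_le (leqnn N) time ctr peelP P) => //.
- by apply/subsetP=> z /selR /(subsetP RC).
- by move=> u /PP [].
- by move=> u /PP [].
- move=> u v; rewrite !inE => /eqP su /eqP + E; rewrite -E su.
  by move=> [].
- move=> t y t0 cy; have /card_gt1P [z [w [zR wR zw]]] := R2 _ _ t0 cy.
  move: zR wR; rewrite !inE => /andP [zR zt] /andP [wR wt].
  have [u su] : exists u, sel t = Some u.
    rewrite /sel; case: pickP => [u _|/(_ (z, w))]; first by exists u.
    by rewrite /= zw zR wR zt wt.
  have tu : time u.1 = t.
    by move: su; rewrite /sel; case: pickP => // v /and5P [_ _ _ /eqP + _] [<-].
  by exists u => //; rewrite inE tu su.
- by move=> z w p /selR zR /selR wR; apply: Rinj.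
- by move=> z w /selR zR /selR wR; apply: Rindep.
Qed.

(** With identical lists everywhere, the neighbors of a vertex still need distinct colors. *)
Lemma inj_choosable_maxdeg (k : nat) : inj_choosable e k -> maxdeg e <= k.
Proof.
move=> chk; have [|c [cL cI]] := chk (fun=> iota 0 k).
  by move=> v; rewrite iota_uniq size_iota.
apply/bigmax_leqP=> v _; rewrite /deg cardE -(size_map c) -[k](size_iota 0).
apply: uniq_leq_size => [|_ /mapP [x _ ->]]; last exact: cL.
rewrite map_inj_in_uniq ?enum_uniq // => x y; rewrite !mem_enum !inE => vx vy E.
apply/eqP; apply: contraT => xy; have := cI _ _ xy; rewrite E eqxx; apply.
by apply/existsP; exists v; rewrite ![e _ v]e_sym vx.
Qed.

Lemma mad_ge (S : {set T}) : S != set0 ->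
  (2 * INR #|induced_edges e S| / INR #|S| <= mad e)%R.
Proof.
rewrite /mad => S0; have := mem_index_enum S.
elim: (index_enum _) => [|A s IH] //; rewrite inE big_cons => /orP [/eqP <-|/IH h].
  by rewrite S0; apply: Rmax_l.
by case: ifP => // _; apply: Rle_trans h (Rmax_r _ _).
Qed.

(** Since [3 - eps] is at most [(3 * n - 1) / n], clearing denominators gives a density bound in
    natural numbers. *)
Lemma mad_density (eps : R) (n : nat) : (1 <= INR n * eps)%R -> (mad e < 3 - eps)%R ->
  forall S : {set T}, S != set0 ->
    2 * n * #|induced_edges e S| < (3 * n - 1) * #|S|.
Proof.
move=> n_eps madlt S S0; have S_gt0 : 0 < #|S| by rewrite card_gt0.
have n_gt0 : 0 < n by case: n n_eps => //=; lra.
suff : 2 * n * #|induced_edges e S| + #|S| < 3 * n * #|S| by nia.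
have := mad_ge S0; set E := #|_|; set s := #|S| in S_gt0 *.
have s0 : (0 < INR s)%R by apply: lt_0_INR; apply/ltP.
have n0 : (0 < INR n)%R by apply: lt_0_INR; apply/ltP.
move=> h; have {}h : (2 * INR E < (3 - eps) * INR s)%R.
  apply: (Rmult_lt_reg_r (/ INR s)); first exact: Rinv_0_lt_compat.
  have -> : ((3 - eps) * INR s * / INR s = 3 - eps)%R by field; lra.
  by move: h; rewrite /Rdiv; lra.
apply/ltP/INR_lt; rewrite -!multE -plusE plus_INR !mult_INR /=.
have := Rmult_lt_compat_l _ _ _ n0 h.
have := Rmult_le_compat_r _ _ _ (Rlt_le _ _ s0) n_eps; lra.
Qed.

End Choosability.

Theorem theorem2 :
  exists f : R -> R,
    forall eps : R, (0 < eps)%R ->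
    forall (T : finType) (e : rel T),
      symmetric e -> irreflexive e ->
      (mad e < 3 - eps)%R ->
      (f eps <= INR (maxdeg e))%R ->
      list_inj_chromatic_eq e (maxdeg e).
Proof.
(* [up] rounds to an integer above [1 / eps], so [n eps * eps] is at least 1. *)
pose n eps := Z.to_nat (up (1 / eps)).
exists (fun eps => INR (degree_bound (n eps))) => eps eps_gt0 T e e_sym e_irr madlt dlt.
have n_eps : (1 <= INR (n eps) * eps)%R.
  have [up_gt _] := archimed (1 / eps).
  have inv_gt0 : (0 < 1 / eps)%R by apply: Rdiv_lt_0_compat; lra.
  rewrite INR_IZR_INZ Z2Nat.id; last by apply: le_IZR; lra.
  have : (1 / eps * eps = 1)%R by field; lra.
  by have := Rmult_lt_compat_r _ _ _ eps_gt0 up_gt; lra.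
have n_gt0 : 0 < n eps by case: (n eps) n_eps => //=; lra.
split; last by move=> k' lt /(inj_choosable_maxdeg e_sym); lia.
apply: (sparse_inj_choosable e_sym e_irr n_gt0).
- by apply/leP/INR_le.
- by move=> y; rewrite [#|_|]/(deg e y); apply: leq_bigmax.
- exact: mad_density n_eps madlt.
Qed.
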